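(* Let $m\ge2$ and let $S_m=\langle d_1,\dots,d_m\rangle$ be a numerical semigroup minimally generated by $m$ elements. Then for every integer $p\ge-1$ $$\sum_{k=m-1}^{m+p}{\mathfrak S}^{m+p}_k\,\mathbb{C}_k(S_m)=(-1)^m\frac{(m+p)!}{(p+1)!}\,\Pi_{p+1},$$ where, for $r\ge0$, $$\Pi_r=\Psi_r+r\sum_{k=0}^{r-1}\binom{r-1}{k}\Psi_{r-k-1}\Phi_k,\qquad \Phi_k=\sum_{i=0}^k{\mathfrak S}^k_i\,G_i .$$
   Context: A numerical semigroup $S_m=\langle d_1,\dots,d_m\rangle$ is the additive submonoid of $\mathbb{Z}_{\ge 0}$ minimally generated by positive integers $d_1,\dots,d_m$ with $\gcd(d_1,\dots,d_m)=1$. Its genera are $G_r=\sum_{s\in\mathbb{Z}_{>0}\setminus S_m}s^r$, $r\ge0$. The degrees of syzygies $C_{k,j}$ ($1\le k\le m-1$, $1\le j\le\beta_k$) and Betti numbers $\beta_k$ are the degree shifts and ranks of the free modules in the minimal graded free resolution of the semigroup ring of $S_m$ over a polynomial ring in $m$ variables of degrees $d_1,\dots,d_m$, so that $\sum_{s\in S_m}z^s=\bigl(1+\sum_{k=1}^{m-1}(-1)^k\sum_{j=1}^{\beta_k}z^{C_{k,j}}\bigr)/\prod_{i=1}^m(1-z^{d_i})$. The alternating power sums are $$\mathbb{C}_n(S_m)=\sum_{k=1}^{m-1}(-1)^{k+1}\sum_{j=1}^{\beta_k}C_{k,j}^n .$$ ${\mathfrak S}^n_k$ are the signed Stirling numbers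 of the first kind: $x(x-1)\cdots(x-n+1)=\sum_{k=0}^n{\mathfrak S}^n_kx^k$. Finally $\Psi_r$ is the $r$-th derivative at $z=1$ of the polynomial $\Psi(z)=\prod_{j=1}^m\sum_{k=0}^{d_j-1}z^k$. (It is known that $\mathbb{C}_0(S_m)=1$, $\mathbb{C}_r(S_m)=0$ for $1\le r\le m-2$, and $\mathbb{C}_{m-1}(S_m)=(-1)^m(m-1)!\prod_i d_i$.) *)

(* Defs.v *)
From mathcomp Require Import all_boot all_order all_algebra.
From mathcomp.multinomials Require Import mpoly.

Set Implicit Arguments.
Unset Strict Implicit.
Unset Printing Implicit Defensive.

Import GRing.Theory.

Section Semigroup.

Variables (m : nat) (d : 'I_m -> nat).

Definition in_semigroup (s : nat) : Prop :=
  exists a : 'I_m -> nat, s = (\sum_(i < m) a i * d i)%N.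

Definition minimally_generates : Prop :=
  [/\ forall i, (0 < d i)%N,
      \big[gcdn/0]_(i < m) d i = 1%N
    & forall i, ~ exists a : 'I_m -> nat,
        d i = (\sum_(j < m | j != i) a j * d j)%N].

(* Decidable membership: for positive generators the coefficients in a
   representation of s are at most s; see in_semigroupP. *)
Definition in_semigroupb (s : nat) : bool :=
  [exists a : {ffun 'I_m -> 'I_s.+1}, s == (\sum_(i < m) a i * d i)%N].

(* The cut-off (sum of the d i)^2 exceeds every gap when the gcd of the d i
   is 1; see mem_gaps. *)
Definition gaps : seq nat :=
  [seq s <- iota 1 ((\sum_(i < m) d i) ^ 2) | ~~ in_semigroupb s].

Definition genus (r : nat) : int := (\sum_(s <- gaps) s%:Z ^+ r)%R.

Lemma in_semigroupP s :
  (forall i, 0 < d i)%N -> reflect (in_semigroup s) (in_semigroupb s).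
Proof.
move=> d_gt0; apply: (iffP existsP) => [[a /eqP Es]|[a Es]].
  by exists (fun i => val (a i)).
have le_as i : (a i < s.+1)%N.
  rewrite ltnS Es (bigD1 i) //= (leq_trans _ (leq_addr _ _)) //.
  exact: leq_pmulr.
exists [ffun i => Ordinal (le_as i)]; rewrite {1}Es.
by apply/eqP/eq_bigr => i _; rewrite ffunE.
Qed.

Lemma gcd_combination_mod n : (0 < n)%N ->
  exists a : 'I_m -> nat,
    (\sum_(i < m) a i * d i = \big[gcdn/0]_(i < m) d i %[mod n])%N.
Proof.
case: n => // n _.
apply: (big_ind (fun g => exists a : 'I_m -> nat,
          (\sum_(i < m) a i * d i = g %[mod n.+1])%N)).
- by exists (fun=> 0); rewrite big1.
- move=> x y [a Ea] [b Eb]; have [->|x_gt0] := posnP x.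
    by exists b; rewrite gcd0n.
  case: (egcdnP y x_gt0) => km kn Ekm _.
  exists (fun i => km * a i + (n * kn) * b i)%N.
  under eq_bigr => i _ do rewrite mulnDl -!mulnA.
  rewrite big_split /= -!big_distrr /=.
  have eqM k u v : (u = v %[mod n.+1] -> k * u = k * v %[mod n.+1])%N.
    by move=> Euv; rewrite -modnMmr Euv modnMmr.
  rewrite -modnDm (eqM _ _ _ Ea) (eqM _ _ _ (eqM _ _ _ Eb)) modnDm Ekm.
  by rewrite addnAC -mulSn mulnC modnMDl.
- move=> i _; exists (fun j => nat_of_bool (j == i)).
  rewrite (bigD1 i) //= eqxx mul1n big1 ?addn0 // => j /negPf->.
  by rewrite mul0n.
Qed.

Lemma in_semigroup_large s :
  \big[gcdn/0]_(i < m) d i = 1%N -> (forall i, 0 < d i)%N ->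
  ((\sum_(i < m) d i) ^ 2 <= s)%N -> in_semigroup s.
Proof.
move=> gcd1 d_gt0 le_s.
have [i0 _|no_i] := pickP (fun _ : 'I_m => true); last first.
  by move: gcd1; rewrite big1 // => i; have := no_i i.
have [a] := gcd_combination_mod (d_gt0 i0); rewrite gcd1 => Ea.
pose c i := ((s * a i) %% d i0)%N.
pose t := (\sum_(i < m | i != i0) c i * d i)%N.
have le_ts : (t <= s)%N.
  apply: leq_trans le_s; rewrite expnS expn1 [X in (_ <= _ * X)%N](bigD1 i0) //=.
  rewrite mulnDr (leq_trans _ (leq_addl _ _)) // big_distrr /=.
  apply: leq_sum => i _; rewrite leq_mul2r.
  rewrite (leq_trans (ltnW (ltn_pmod _ (d_gt0 i0)))) ?orbT //.
  by rewrite (bigD1 i0) //= leq_addr.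
have Et : (t = s %[mod d i0])%N.
  rewrite -[in RHS](muln1 s) -[in RHS]modnMmr -Ea modnMmr big_distrr /=.
  rewrite [in RHS](bigD1 i0) //= !mulnA -[in RHS]modnDml modnMl add0n.
  rewrite /t -[LHS]modn_summ -[RHS]modn_summ; congr (_ %% _)%N.
  by apply: eq_bigr => i _; rewrite /c modnMml mulnA.
have /dvdnP[q Eq] : (d i0 %| s - t)%N by rewrite -eqn_mod_dvd //; apply/eqP.
exists (fun i => if i == i0 then q else c i).
rewrite (bigD1 i0) //= eqxx -Eq; set u := (\sum_(i < m | _) _)%N.
suff -> : u = t by rewrite subnK.
by apply: eq_bigr => i /negPf->.
Qed.

Lemma mem_gaps s : minimally_generates ->
  reflect ((0 < s)%N /\ ~ in_semigroup s) (s \in gaps).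
Proof.
case=> d_gt0 gcd1 _; rewrite mem_filter mem_iota add1n ltnS.
apply: (iffP and3P) => [[/(in_semigroupP s d_gt0) sS s_gt0 _]|[s_gt0 sS]] //.
split=> //; first exact/(in_semigroupP s d_gt0).
by rewrite leqNgt; apply/negP => /ltnW le_s; apply: sS; apply: in_semigroup_large.
Qed.

Lemma gaps_uniq : uniq gaps.
Proof. by rewrite filter_uniq ?iota_uniq. Qed.

End Semigroup.

Local Open Scope ring_scope.

Section Resolution.

Variables (K : fieldType) (m : nat) (d : 'I_m -> nat).

(* The degree of a monomial in the polynomial ring in m variables graded by
   deg X_i = d i. *)
Definition wdeg (mon : 'X_{1..m}) : nat := (\sum_(i < m) mon i * d i)%N.

(* The graded ring morphism K[X_1, ..., X_m] -> K[t], X_i |-> t^(d i), whose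
   image is the semigroup ring K[S], see semigroup_ringP; it makes K[S] a cyclic
   graded module over the polynomial ring. *)
Definition semigroup_map (f : {mpoly K[m]}) : {poly K} :=
  mmap polyC (fun i => 'X^(d i)) f.

Lemma semigroup_map_monomial (mon : 'X_{1..m}) :
  mmap1 (fun i => 'X^(d i) : {poly K}) mon = 'X^(wdeg mon).
Proof.
rewrite /mmap1 /wdeg -prodrXr; apply: eq_bigr => i _.
by rewrite mulnC exprM.
Qed.

Lemma semigroup_ringP (q : {poly K}) :
  (forall s, q`_s != 0 -> in_semigroup d s) <->
  exists f, q = semigroup_map f.
Proof.
split=> [qS|[f ->] s].
  have {}qS (i : 'I_(size q)) : exists f, q`_i *: 'X^i = semigroup_map f.
    have [->|/qS[a Ei]] := eqVneq q`_i 0.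
      by exists 0; rewrite scale0r /semigroup_map mmap0.
    exists (q`_i *: 'X_[[multinom a j | j < m]]).
    rewrite /semigroup_map mmapZ mmapX semigroup_map_monomial mul_polyC.
    congr (_ *: 'X^_); rewrite [LHS]Ei.
    by apply: eq_bigr => j _; rewrite mnmE.
  rewrite -[q]coefK poly_def; elim/big_ind: _ => [|x y [f ->] [g ->]|i _] //.
    by exists 0; rewrite /semigroup_map mmap0.
  by exists (f + g); rewrite /semigroup_map mmapD.
rewrite /semigroup_map /mmap coef_sum => nz.
have /hasP[mon _ /=] : has (fun mon => (s == wdeg mon)) (msupp f).
  apply: contraNT nz => /hasPn no; apply/eqP; rewrite big_seq big1 // => mon.
  move=> /no /negPf ne.
  by rewrite semigroup_map_monomial mul_polyC coefZ coefXn ne mulr0.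
by move=> /eqP->; exists mon.
Qed.

(* The minimal graded free resolution
     0 -> F_{m-1} -> ... -> F_1 -> F_0 = R -> K[S] -> 0,
   R = K[X_1, ..., X_m],  F_k = sum over j < betti k of R(- syzdeg k j).
   Elements of F_k are row vectors, and diff k : F_{k+1} -> F_k acts by right
   multiplication. The index k runs over all of nat, with F_k = 0 for k >= m
   (K[S] has projective dimension m - 1), so that the exactness at F_{m-1} is the
   injectivity of F_{m-1} -> F_{m-2}. *)
Record minimal_resolution : Type := MinimalResolution {
  betti : nat -> nat;
  syzdeg : forall k, 'I_(betti k) -> nat;
  diff : forall k, 'M[{mpoly K[m]}]_(betti k.+1, betti k);
  betti_0 : betti 0 = 1%N;
  syzdeg_0 : forall j : 'I_(betti 0), syzdeg j = 0%N;
  betti_ge : forall k, (m <= k)%N -> betti k = 0%N;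
  (* each diff k is homogeneous of degree 0 for the shifted gradings *)
  diff_homogeneous : forall k (i : 'I_(betti k.+1)) (j : 'I_(betti k)) mon,
    mon \in msupp (diff k i j) -> (wdeg mon + syzdeg j)%N = syzdeg i;
  (* minimality: the image of diff k lies in (X_1, ..., X_m) F_k *)
  diff_minimal : forall k (i : 'I_(betti k.+1)) (j : 'I_(betti k)),
    (diff k i j)@_0%MM = 0;
  (* exactness at F_0; the sum has the single index j of 'I_(betti 0) *)
  exact_0 : forall v : 'rV[{mpoly K[m]}]_(betti 0),
    \sum_j semigroup_map (v 0 j) = 0 <-> exists w, v = w *m diff 0;
  exact_S : forall k (v : 'rV[{mpoly K[m]}]_(betti k.+1)),
    v *m diff k = 0 <-> exists w, v = w *m diff k.+1
}.

Definition alt_power_sum (F : minimal_resolution) (n : nat) : int :=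
  \sum_(1 <= k < m) (-1) ^+ k.+1 * \sum_(j < betti F k) (syzdeg j)%:Z ^+ n.

End Resolution.

Definition stirling1 (n k : nat) : int :=
  (\prod_(i < n) ('X - (i%:R)%:P) : {poly int})`_k.

Section Pi.

Variables (m : nat) (d : 'I_m -> nat).

Definition Psi_poly : {poly int} := \prod_(j < m) \sum_(k < d j) 'X^k.

Definition Psi (r : nat) : int := (Psi_poly^`(r)).[1].

Definition Phi (k : nat) : int :=
  \sum_(i < k.+1) stirling1 k i * genus d i.

(* For r = 0 the truncated r.-1 is harmless: the sum is empty. *)
Definition Pi (r : nat) : int :=
  Psi r + r%:R *
    \sum_(k < r) 'C(r.-1, k)%:R * Psi (r - k - 1)%N * Phi k.

End Pi.

(* Main.v *)
Require Import Defs.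
From HB Require Import structures.
From mathcomp Require Import all_boot all_order all_algebra.
From mathcomp.multinomials Require Import mpoly.
From mathcomp Require Import ring zify.

(* In each degree s the resolution is an exact sequence of finite-dimensional
   vector spaces, so the alternating sum of the dimensions is 1 if s is in S_m
   and 0 otherwise. Multiplying by the truncated series of 1 / prod (1 - z^(d i))
   and letting the truncation order grow turns this into the polynomial identity
     1 + sum_k (-1)^k sum_j z^(C_kj)
       = (1 - z)^(m-1) Psi(z) - (1 - z)^m Psi(z) sum_(gaps) z^s.
   The n-th derivative at z = 1 of the left-hand side is minus the Stirling
   combination of the alternating power sums; that of the right-hand side is read
   off the Taylor coefficients at 1. Its vanishing for n < m - 1 also gives
   C_k(S_m) = 0 for 0 < k < m - 1. *)

Set Implicit Arguments.
Unset Strict Implicit.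
Unset Printing Implicit Defensive.

Import GRing.Theory.
Local Open Scope ring_scope.

(** * Exactness and dimension count in a fixed degree *)

Section GradedPieces.

Variables (K : fieldType) (m : nat) (d : 'I_m -> nat).
Hypothesis d_gt0 : forall i, (0 < d i)%N.
Variables (F : minimal_resolution K d) (M s : nat).
Hypothesis lt_sM : (s < M)%N.

Local Notation R := {mpoly K[m]}.

(** A finite box of exponents that holds every monomial of degree [s], because the weights are
    positive and [s < M]. Keeping [M] apart from [s] lets one box serve all degrees below [M], as
    the truncated series need. *)
Definition exponent (a : {ffun 'I_m -> 'I_M}) : 'X_{1..m} :=
  [multinom val (a i) | i < m].

Lemma exponent_inj : injective exponent.
Proof.
move=> a b /mnmP eq_ab; apply/ffunP => i; apply: val_inj.
by have := eq_ab i; rewrite !mnmE.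
Qed.

Lemma wdegD (m1 m2 : 'X_{1..m}) : wdeg d (m1 + m2)%MM = (wdeg d m1 + wdeg d m2)%N.
Proof.
by rewrite /wdeg -big_split; apply: eq_bigr => i _; rewrite mnmDE mulnDl.
Qed.

Lemma exponent_surj (mon : 'X_{1..m}) :
  (wdeg d mon <= s)%N -> exists a, exponent a = mon.
Proof.
move=> le_s; have lt_M i : (mon i < M)%N.
  apply: leq_ltn_trans lt_sM; apply: leq_trans le_s.
  by rewrite /wdeg (bigD1 i) //= (leq_trans _ (leq_addr _ _)) // leq_pmulr.
exists [ffun i => Ordinal (lt_M i)].
by apply/mnmP => i; rewrite mnmE ffunE.
Qed.

(* Monomial basis of the piece of degree s of the free module F_k. *)
Definition piece k := {x : 'I_(betti F k) * {ffun 'I_m -> 'I_M} |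
  (wdeg d (exponent x.2) + syzdeg x.1 == s)%N}.

Definition of_coefs k (u : {ffun piece k -> K^o}) : 'rV[R]_(betti F k) :=
  \row_j \sum_(x : piece k | (val x).1 == j) u x *: 'X_[exponent (val x).2].

Definition to_coefs k (v : 'rV[R]_(betti F k)) : {ffun piece k -> K^o} :=
  [ffun x : piece k => (v 0 (val x).1)@_(exponent (val x).2)].

Lemma mcoeff_of_coefs k (u : {ffun piece k -> K^o}) (x : piece k) :
  (of_coefs u 0 (val x).1)@_(exponent (val x).2) = u x.
Proof.
rewrite mxE raddf_sum (bigD1 x) //= mcoeffZ mcoeffX eqxx mulr1 big1 ?addr0 //.
move=> y /andP[/eqP eq1 ne]; rewrite mcoeffZ mcoeffX.
case: eqP => [/exponent_inj eq2|_]; last by rewrite mulr0.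
by case/eqP: ne; apply: val_inj;
  rewrite [LHS]surjective_pairing eq1 eq2 -surjective_pairing.
Qed.

Lemma of_coefsK k : cancel (@of_coefs k) (@to_coefs k).
Proof. by move=> u; apply/ffunP => x; rewrite ffunE mcoeff_of_coefs. Qed.

Lemma mcoeff_of_coefs_out k (u : {ffun piece k -> K^o}) j mon :
  (wdeg d mon + syzdeg j != s)%N -> (of_coefs u 0 j)@_mon = 0.
Proof.
move=> ne; rewrite mxE raddf_sum big1 //= => x /eqP eq_j.
rewrite mcoeffZ mcoeffX; case: eqP => [eq_mon|_]; last by rewrite mulr0.
by case/eqP: ne; rewrite -eq_mon -eq_j; apply/eqP: (valP x).
Qed.

(** [of_coefs] embeds the piece of degree [s] into F_k and [to_coefs] projects onto it; their
    composite is the homogeneous component of degree [s]. *)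
Lemma mcoeff_component k (v : 'rV[R]_(betti F k)) j mon :
  (of_coefs (to_coefs v) 0 j)@_mon =
  if (wdeg d mon + syzdeg j == s)%N then (v 0 j)@_mon else 0.
Proof.
have [eq_s|ne] := eqVneq; last exact: mcoeff_of_coefs_out.
have [|a eq_a] := @exponent_surj mon; first by rewrite -eq_s leq_addr.
have xP : (wdeg d (exponent (j, a).2) + syzdeg (j, a).1 == s)%N.
  by rewrite /= eq_a eq_s.
have := mcoeff_of_coefs (to_coefs v) (exist _ (j, a) xP : piece k).
by rewrite ffunE /= eq_a.
Qed.

(* diff k is homogeneous, hence commutes with taking the component of degree s. *)
Lemma component_mul k (v : 'rV[R]_(betti F k.+1)) :
  of_coefs (to_coefs v) *m diff F k = of_coefs (to_coefs (v *m diff F k)).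
Proof.
apply/rowP => j; apply/mpolyP => mon; rewrite mcoeff_component !mxE.
rewrite !raddf_sum /=.
have {}E i : (of_coefs (to_coefs v) 0 i * diff F k i j)@_mon =
    if (wdeg d mon + syzdeg j == s)%N then (v 0 i * diff F k i j)@_mon else 0.
  rewrite !mcoeffM; set c := (_ == s).
  rewrite [RHS](_ : _ = \sum_(k0 : 'X_{1..m < (mdeg mon).+1, (mdeg mon).+1} |
     mon == (k0.1 + k0.2)%MM)
     if c then (v 0 i)@_k0.1 * (diff F k i j)@_k0.2 else 0); last first.
    by case: c => //; rewrite big1.
  apply: eq_bigr => -[m1 m2] /= /eqP eq_mon; rewrite mcoeff_component.
  (* A monomial [m2] that occurs in entry (i, j) satisfies [wdeg d m2 + syzdeg j = syzdeg i], so the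
     degree condition on [m1] at index [i] is the one on [mon] at index [j]. *)
  have [->|nz] := eqVneq ((diff F k i j)@_m2) 0.
    by rewrite !mulr0; case: c.
  have Ei : (wdeg d m2 + syzdeg j)%N = syzdeg i.
    by apply: (diff_homogeneous (i := i)); rewrite mcoeff_msupp.
  rewrite -Ei addnA -wdegD -eq_mon -/c.
  by case: c; rewrite ?mul0r.
under eq_bigr => i _ do rewrite E.
by case: ifP => _ //; rewrite big1.
Qed.

Lemma of_coefs_linear (a : K) k (u v : {ffun piece k -> K^o}) :
  of_coefs (a *: u + v) = a%:MP *: of_coefs u + of_coefs v.
Proof.
apply/rowP => j; rewrite !mxE mulr_sumr -big_split /=.
by apply: eq_bigr => x _; rewrite !ffunE scalerDl -scalerA mul_mpolyC.
Qed.

Lemma to_coefs_linear (a : K) k (u v : 'rV[R]_(betti F k)) :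
  to_coefs (a%:MP *: u + v) = a *: to_coefs u + to_coefs v.
Proof. by apply/ffunP => x; rewrite !ffunE !mxE mcoeffD mcoeffCM. Qed.

Lemma of_coefs0 k : of_coefs (0 : {ffun piece k -> K^o}) = 0.
Proof. by apply/rowP=> j; rewrite !mxE big1 // => x _; rewrite ffunE scale0r. Qed.

Lemma to_coefs0 k : to_coefs (0 : 'rV[R]_(betti F k)) = 0.
Proof. by apply/ffunP => x; rewrite !ffunE mxE mcoeff0. Qed.

Definition piece_diff k (u : {ffun piece k.+1 -> K^o}) :
  {ffun piece k -> K^o} := to_coefs (of_coefs u *m diff F k).

Lemma piece_diff_linear k : linear (@piece_diff k).
Proof.
move=> a u v; rewrite /piece_diff of_coefs_linear mulmxDl -scalemxAl.
exact: to_coefs_linear.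
Qed.

HB.instance Definition _ k := GRing.isLinear.Build K
  {ffun piece k.+1 -> K^o} {ffun piece k -> K^o} *:%R (@piece_diff k)
  (@piece_diff_linear k).

Lemma of_coefs_piece_diff k (u : {ffun piece k.+1 -> K^o}) :
  of_coefs (piece_diff u) = of_coefs u *m diff F k.
Proof. by rewrite /piece_diff -component_mul of_coefsK. Qed.

Lemma piece_diff_component k (w : 'rV[R]_(betti F k.+1)) :
  piece_diff (to_coefs w) = to_coefs (w *m diff F k).
Proof. by rewrite /piece_diff component_mul of_coefsK. Qed.

(** A cycle of degree [s] has some preimage by exactness of the resolution, and the degree [s]
    component of that preimage is again a preimage. *)
Lemma piece_exact_S k (u : {ffun piece k.+1 -> K^o}) :
  piece_diff u = 0 <-> exists w, u = piece_diff (k := k.+1) w.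
Proof.
split=> [u0|[w ->]].
  have /exact_S[w Ew] : of_coefs u *m diff F k = 0.
    by rewrite -of_coefs_piece_diff u0 of_coefs0.
  by exists (to_coefs w); rewrite piece_diff_component -Ew of_coefsK.
rewrite [LHS]/piece_diff of_coefs_piece_diff.
suff -> : of_coefs w *m diff F k.+1 *m diff F k = 0 by exact: to_coefs0.
by apply/exact_S; exists (of_coefs w).
Qed.

(** The degree [s] part of F_0 -> K[S]: every monomial of degree [s] maps to t^s, so only the sum of
    the coefficients survives. *)
Definition piece_augmentation (u : {ffun piece 0 -> K^o}) : K^o := \sum_x u x.

Lemma piece_augmentation_linear : linear piece_augmentation.
Proof.
move=> a u v; rewrite /piece_augmentation scaler_sumr -big_split /=.
by apply: eq_bigr => x _; rewrite !ffunE.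
Qed.

HB.instance Definition _ := GRing.isLinear.Build K
  {ffun piece 0 -> K^o} K^o *:%R piece_augmentation piece_augmentation_linear.

Lemma semigroup_map_of_coefs (u : {ffun piece 0 -> K^o}) :
  \sum_j semigroup_map d (of_coefs u 0 j) = (piece_augmentation u)%:P * 'X^s.
Proof.
rewrite /piece_augmentation rmorph_sum mulr_suml /=.
rewrite [RHS](partition_big (fun x : piece 0 => (val x).1) predT) //=.
apply: eq_bigr => j _; rewrite mxE /semigroup_map.
rewrite (big_morph _ (mmapD _ _) (mmap0 _ _)); apply: eq_bigr => x /eqP Ej.
rewrite mmapZ mmapX semigroup_map_monomial.
by have /eqP := valP x; rewrite syzdeg_0 addn0 => ->.
Qed.

Lemma piece_exact_0 (u : {ffun piece 0 -> K^o}) :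
  piece_augmentation u = 0 <-> exists w, u = piece_diff (k := 0) w.
Proof.
split=> [u0|[w Ew]].
  have /exact_0[w Ew] : \sum_j semigroup_map d (of_coefs u 0 j) = 0.
    by rewrite semigroup_map_of_coefs u0 mul0r.
  by exists (to_coefs w); rewrite piece_diff_component -Ew of_coefsK.
have := semigroup_map_of_coefs u.
have /exact_0-> : exists w, of_coefs u = w *m diff F 0.
  by exists (of_coefs w); rewrite Ew of_coefs_piece_diff.
move/(congr1 (fun p : {poly K} => p`_s)).
by rewrite coef0 mul_polyC coefZ coefXn eqxx mulr1.
Qed.

Lemma dim_piece k : \dim {:{ffun piece k -> K^o}} = #|{: piece k}|.
Proof. by rewrite dimvf /dim /= muln1. Qed.

Let rk k := \dim (limg (linfun (@piece_diff k))).

(** Rank-nullity: by exactness the kernel of [piece_diff] at [k] is the image of the next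
    differential. *)
Lemma card_piece_S k : #|{: piece k.+1}| = (rk k.+1 + rk k)%N.
Proof.
rewrite -dim_piece -(limg_ker_dim (linfun (@piece_diff k))) capfv.
congr (\dim _ + _)%N; apply/vspaceP => u; rewrite memv_ker lfunE.
apply/eqP/memv_imgP => [/piece_exact_S[w ->]|[w _ ->]].
  by exists w; rewrite ?memvf ?lfunE.
by apply/piece_exact_S; exists w; rewrite lfunE.
Qed.

(** Rank-nullity for the augmentation, whose image is the degree [s] part of K[S]: a line if some
    monomial has degree [s], and zero otherwise. *)
Lemma card_piece_0 : #|{: piece 0}| = (rk 0 + in_semigroupb d s)%N.
Proof.
rewrite -dim_piece -(limg_ker_dim (linfun piece_augmentation)) capfv.
congr (_ + _)%N.
  congr (\dim _)%N; apply/vspaceP => u; rewrite memv_ker lfunE.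
  apply/eqP/memv_imgP => [/piece_exact_0[w ->]|[w _ ->]].
    by exists w; rewrite ?memvf ?lfunE.
  by apply/piece_exact_0; exists w; rewrite lfunE.
case: (in_semigroupP s d_gt0) => [[a Es]|notS].
  have Ew : wdeg d [multinom a i | i < m] = s.
    by rewrite Es; apply: eq_bigr => i _; rewrite mnmE.
  have [|b Eb] := @exponent_surj [multinom a i | i < m]; first by rewrite Ew.
  have j0 : 'I_(betti F 0) by rewrite betti_0; exact: ord0.
  have xP : (wdeg d (exponent (j0, b).2) + syzdeg (j0, b).1 == s)%N.
    by rewrite /= Eb Ew syzdeg_0 addn0.
  pose x0 : piece 0 := exist _ (j0, b) xP.
  apply/eqP; rewrite eqn_leq; apply/andP; split.
    by rewrite (leq_trans (dimvS (subvf _))) // dimvf.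
  rewrite lt0n dimv_eq0; apply/negP => /eqP img0.
  have : linfun piece_augmentation [ffun x => (x == x0)%:R] \in
         limg (linfun piece_augmentation) by rewrite memv_img ?memvf.
  rewrite img0 memv0 lfunE /= /piece_augmentation (bigD1 x0) //= ffunE eqxx big1.
    by rewrite addr0 oner_eq0.
  by move=> x /negPf ne; rewrite ffunE ne.
apply/eqP; rewrite dimv_eq0 -subv0; apply/subvP => _ /memv_imgP[u _ ->].
rewrite memv0 lfunE /= /piece_augmentation big1 // => x _; case: notS.
exists (exponent (val x).2); apply/esym; have /eqP := valP x.
by rewrite syzdeg_0 addn0.
Qed.

Lemma alt_sum_card_piece :
  \sum_(k < m) (-1) ^+ k * #|{: piece k}|%:Z = (in_semigroupb d s)%:Z.
Proof.
(* The sum telescopes, leaving the rank of one differential; it vanishes for [n = m] because the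
   piece at [m.+1] is empty. *)
have partial n : \sum_(k < n.+1) (-1) ^+ k * #|{: piece k}|%:Z =
    (in_semigroupb d s)%:Z + (-1) ^+ n * (rk n)%:Z.
  elim: n => [|n IHn]; first by rewrite big_ord1 card_piece_0 PoszD !mul1r addrC.
  by rewrite big_ord_recr /= IHn card_piece_S exprS PoszD; ring.
have card0 k : (m <= k)%N -> #|{: piece k}| = 0%N.
  by move=> le_mk; apply: eq_card0 => x; have := ltn_ord (val x).1;
  rewrite [X in (_ < X)%N]betti_ge.
have := partial m; rewrite big_ord_recr /= card0 // mulr0 addr0.
have /eqP := card_piece_S m; rewrite card0 // eq_sym addn_eq0 => /andP[_ /eqP->].
by rewrite mulr0 addr0.
Qed.

End GradedPieces.

(** * Congruence of polynomials modulo X^M *)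

Definition eqXn (M : nat) (p q : {poly int}) : Prop := exists c, p = q + c * 'X^M.

Lemma eqXnP M (p q : {poly int}) : (forall s, (s < M)%N -> p`_s = q`_s) -> eqXn M p q.
Proof.
move=> eq_pq; exists (drop_poly M (p - q)).
rewrite -[LHS](subrK q) addrC -{1}[p - q](poly_take_drop M).
suff -> : take_poly M (p - q) = 0 by rewrite add0r.
apply/polyP => i; rewrite coef_take_poly coef0 coefB.
by case: ltnP => // /eq_pq->; rewrite subrr.
Qed.

Lemma eqXn_trans M p q r : eqXn M p q -> eqXn M q r -> eqXn M p r.
Proof. by case=> a -> [b ->]; exists (b + a); ring. Qed.

Lemma eqXn_sym M p q : eqXn M p q -> eqXn M q p.
Proof. by case=> a ->; exists (- a); ring. Qed.

Lemma eqXnM M p q p' q' : eqXn M p q -> eqXn M p' q' -> eqXn M (p * p') (q * q').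
Proof.
by case=> a -> [b ->]; exists (a * q' + q * b + a * b * 'X^M); ring.
Qed.

Lemma eqXn_refl M p : eqXn M p p.
Proof. by exists 0; ring. Qed.

Lemma eqXn_prod1 M (I : finType) (P : I -> {poly int}) :
  (forall i, eqXn M (P i) 1) -> eqXn M (\prod_i P i) 1.
Proof.
move=> P1; elim/big_rec: _ => [|i p _ IHp]; first exact: eqXn_refl.
by rewrite -[1]mulr1; apply: eqXnM.
Qed.

(** This replaces formal power series: an identity of polynomials may be proved with truncated
    series, the truncation order being arbitrary. *)
Lemma eqXn_eq p q : (forall M, eqXn M p q) -> p = q.
Proof.
move=> eq_pq; apply/polyP => i; have [c ->] := eq_pq i.+1.
by rewrite coefD coefMXn ltnSn addr0.
Qed.

(* The numerator of the Hilbert series, including the k = 0 term 1. *)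
Definition syzygy_poly K m (d : 'I_m -> nat) (F : minimal_resolution K d) :
  {poly int} := \sum_(k < m) (-1) ^+ k * \sum_(j < betti F k) 'X^(syzdeg j).

Definition gap_poly m (d : 'I_m -> nat) : {poly int} := \sum_(s <- gaps d) 'X^s.

(** * The Hilbert series and the closed form of its numerator *)

Section HilbertSeries.

Variables (K : fieldType) (m : nat) (d : 'I_m -> nat).
Hypothesis hd : minimally_generates d.
Variable F : minimal_resolution K d.

Let d_gt0 i : (0 < d i)%N. Proof. by case: hd. Qed.

(** Modulo X^M this is 1 / prod (1 - z^(d i)), the Hilbert series of the polynomial ring. Cutting
    each factor after [M] terms makes it a sum over the exponent box. *)
Let geom M : {poly int} := \prod_(i < m) \sum_(a < M) 'X^(a * d i).

Lemma geomE M : geom M = \sum_(a : {ffun 'I_m -> 'I_M}) 'X^(wdeg d (exponent a)).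
Proof.
rewrite /geom bigA_distr_bigA; apply: eq_bigr => a _ /=.
by rewrite prodrXr; congr ('X^_); apply: eq_bigr => i _; rewrite mnmE.
Qed.

(** Each factor telescopes to 1 - X^(M d_i), and M <= M d_i since d_i > 0. *)
Lemma geom_inverse M : eqXn M (geom M * \prod_(i < m) (1 - 'X^(d i))) 1.
Proof.
rewrite -big_split /=; apply: eqXn_prod1 => i.
have -> : (\sum_(a < M) 'X^(a * d i)) * (1 - 'X^(d i)) = 1 - 'X^(M * d i) :> {poly int}.
  rewrite -[1 - 'X^(M * _)]opprB mulnC exprM subrX1 mulrC -mulNr opprB.
  by congr (_ * _); apply: eq_bigr => a _; rewrite mulnC exprM.
exists (- 'X^(M * d i - M)); rewrite mulNr -exprD subnK //.
exact: leq_pmulr.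
Qed.

(** The coefficient of z^s in z^C [geom M] counts the monomials in the box of degree s - C; summed
    over the generators of F_k this is the cardinality of [piece]. *)
Lemma syzygy_geom M s : (s < M)%N ->
  (syzygy_poly F * geom M)`_s = (in_semigroupb d s)%:Z.
Proof.
move=> lt_sM; rewrite -(alt_sum_card_piece d_gt0 F lt_sM) /syzygy_poly.
rewrite mulr_suml coef_sum; apply: eq_bigr => k _.
(* Reducing the sign to a parity leaves two cases, in each of which it passes through the
   coefficient. *)
rewrite -mulrA -signr_odd -[in RHS]signr_odd.
rewrite [LHS](_ : _ = (-1) ^+ odd k *
  ((\sum_(j < betti F k) 'X^(syzdeg j)) * geom M)`_s); last first.
  by case: odd; rewrite ?expr1 ?expr0 ?mulN1r ?coefN ?mul1r.
congr (_ * _); rewrite geomE big_distrlr /= pair_big coef_sum.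
rewrite card_sig -sum1_card -natz natr_sum [RHS]big_mkcond /=.
apply: eq_bigr => x _; rewrite -exprD coefXn addnC eq_sym inE.
by case: eqP.
Qed.

(** The series of S_m is 1/(1 - z) minus the gap polynomial; the factor 1 - z clears the
    denominator. *)
Lemma semigroup_series M :
  eqXn M ((1 - 'X) * (\poly_(s < M) (in_semigroupb d s)%:Z))
    (1 - (1 - 'X) * gap_poly d).
Proof.
have -> : 1 - (1 - 'X) * gap_poly d =
  (1 - 'X) * (\sum_(s < M) 'X^s - gap_poly d) + 'X^M :> {poly int}.
  by rewrite -['X^M](subrK 1) subrX1; ring.
apply: eqXn_trans (_ : eqXn M _ ((1 - 'X) * (\sum_(s < M) 'X^s - gap_poly d))) _.
  apply: eqXnM (eqXn_refl _ _) _; apply: eqXnP => s lt_sM.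
  rewrite coef_poly lt_sM coefB.
  have -> : (\sum_(i < M) 'X^i : {poly int})`_s = 1.
    rewrite coef_sum (bigD1 (Ordinal lt_sM)) //= coefXn eqxx big1 ?addr0 // => i ne.
    by rewrite coefXn; case: eqP => // Es; case/eqP: ne; apply: val_inj.
  have -> : (gap_poly d)`_s = (s \in gaps d)%:Z.
    rewrite coef_sum; case: (boolP (s \in gaps d)) => [s_gap|s_gap].
      rewrite (bigD1_seq s) ?gaps_uniq //= coefXn eqxx big1 ?addr0 // => i ne.
      by rewrite coefXn eq_sym (negPf ne).
    rewrite big_seq big1 // => i i_gap; rewrite coefXn; case: eqP => // Es.
    by rewrite Es i_gap in s_gap.
  case: (in_semigroupP s d_gt0) => sS; case: (mem_gaps s hd) => sG //.
  - by case: sG.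
  (* A non-member that is not a gap would have to be 0, which the zero combination represents. *)
  - case: sG; split => //; rewrite lt0n; apply/eqP => s0; case: sS.
    by exists (fun=> 0%N); rewrite big1.
by apply: eqXn_sym; exists 1; ring.
Qed.

Lemma hilbert_identity :
  (1 - 'X) * syzygy_poly F =
  (\prod_(i < m) (1 - 'X^(d i))) * (1 - (1 - 'X) * gap_poly d).
Proof.
apply: eqXn_eq => M; set D := \prod_(i < m) _.
have synH : eqXn M (syzygy_poly F * geom M) (\poly_(s < M) (in_semigroupb d s)%:Z).
  by apply: eqXnP => s lt_sM; rewrite syzygy_geom // coef_poly lt_sM.
(* Insert [geom M * D], which is 1 modulo X^M, so that the numerator meets the truncated series. *)
apply: eqXn_trans (_ : eqXn M _ ((1 - 'X) * ((syzygy_poly F * geom M) * D))) _.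
  apply: eqXnM (eqXn_refl _ _) _; rewrite -mulrA -[X in eqXn _ X]mulr1.
  exact: eqXnM (eqXn_refl _ _) (eqXn_sym (geom_inverse M)).
rewrite mulrA mulrC; apply: eqXnM (eqXn_refl _ _) _.
apply: eqXn_trans (semigroup_series M).
exact: eqXnM (eqXn_refl _ _) synH.
Qed.

(** Each 1 - X^(d_i) is 1 - X times a factor of [Psi_poly]; one factor 1 - X then cancels, as
    integer polynomials form a domain. *)
Lemma syzygy_polyE :
  (0 < m)%N -> syzygy_poly F =
  (1 - 'X) ^+ m.-1 * Psi_poly d - (1 - 'X) ^+ m * (Psi_poly d * gap_poly d).
Proof.
move=> m_gt0; have nz : 1 - 'X != 0 :> {poly int}.
  by rewrite -opprB oppr_eq0 polyXsubC_eq0.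
apply: (mulfI nz); rewrite hilbert_identity.
have -> : \prod_(i < m) (1 - 'X^(d i)) = (1 - 'X) ^+ m * Psi_poly d.
  rewrite -[X in _ ^+ X]card_ord -prodr_const /Psi_poly -big_split /=.
  by apply: eq_bigr => i _; rewrite -[LHS]opprB subrX1 -mulNr opprB.
have -> : (1 - 'X) ^+ m = (1 - 'X) * (1 - 'X) ^+ m.-1 :> {poly int}.
  by rewrite -exprS prednK.
ring.
Qed.

End HilbertSeries.

(** * Taylor coefficients at 1 and Stirling numbers *)

Definition taylor1 (p : {poly int}) : {poly int} := p \Po ('X + 1).

(** Translation commutes with differentiation, which moves the evaluation from 1 to 0. In Taylor
    coefficients, multiplication by a power of 1 - X is a mere shift up to sign. *)
Lemma derivn_taylor1 (p : {poly int}) n :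
  (p^`(n)).[1] = (taylor1 p)`_n * n`!%:R.
Proof.
have E q k : (taylor1 q)^`(k) = taylor1 q^`(k).
  elim: k q => [//|k IHk] q; rewrite derivSn /taylor1 deriv_comp.
  by rewrite derivD derivX derivC addr0 mulr1 IHk derivSn.
have -> : (p^`(n)).[1] = (taylor1 p^`(n)).[0].
  by rewrite horner_comp !hornerE.
by rewrite -E horner_coef0 coef_derivn addn0 ffactnn mulr_natr.
Qed.

Lemma taylor1M p q : taylor1 (p * q) = taylor1 p * taylor1 q.
Proof. exact: comp_polyM. Qed.

Lemma taylor1B p q : taylor1 (p - q) = taylor1 p - taylor1 q.
Proof. exact: comp_polyB. Qed.

Lemma taylor1_powM a p :
  taylor1 ((1 - 'X) ^+ a * p) = (-1) ^+ a * (taylor1 p * 'X^a).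
Proof.
rewrite taylor1M /taylor1 rmorphXn /= comp_polyB comp_polyX comp_polyC.
have -> : 1 - ('X + 1) = - 'X :> {poly int} by ring.
by rewrite [(- 'X) ^+ a]exprNn -mulrA; congr (_ * _); apply: mulrC.
Qed.

Lemma size_stirling_poly n :
  size (\prod_(i < n) ('X - (i%:R)%:P) : {poly int}) = n.+1.
Proof.
by rewrite -(big_mkord xpredT (fun i => 'X - (i%:R)%:P)) size_prod_XsubC size_iota subn0.
Qed.

Lemma horner_stirling1 n (c : nat) :
  \sum_(k < n.+1) stirling1 n k * c%:Z ^+ k = (c ^_ n)%:Z.
Proof.
rewrite /stirling1; set p := \prod_(i < n) _.
have sz : (size p <= n.+1)%N by rewrite size_stirling_poly.
rewrite -(horner_coef_wide _ sz) horner_prod.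
elim: n {p sz} => [|n IHn]; first by rewrite big_ord0 ffactn0.
rewrite big_ord_recr /= IHn hornerXsubC ffactnSr PoszM.
(* Truncated and integer subtraction differ only for [c < n], where the factor [c ^_ n] is already
   zero. *)
have [le_nc|lt_cn] := leqP n c; first by rewrite -subzn ?natz.
by rewrite ffact_small // !mul0r.
Qed.

Lemma stirling1_lead n : stirling1 n n = 1.
Proof.
have /monicP := monic_prod_XsubC (index_enum 'I_n) xpredT (fun i => i%:R : int).
by rewrite /lead_coef size_stirling_poly.
Qed.

Lemma stirling1_n0 n : (0 < n)%N -> stirling1 n 0 = 0.
Proof.
case: n => // n _; rewrite /stirling1 -horner_coef0 horner_prod big_ord_recl.
by rewrite hornerXsubC subr0 mul0r.
Qed.

Lemma horner_derivnM (p q : {poly int}) n :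
  ((p * q)^`(n)).[1] =
  \sum_(k < n.+1) 'C(n, k)%:R * (p^`(n - k)).[1] * (q^`(k)).[1].
Proof.
rewrite derivn_taylor1 taylor1M coefMr mulr_suml; apply: eq_bigr => k _.
rewrite !derivn_taylor1 -(bin_fact (ltn_ord k : (k <= n)%N)) !natrM; ring.
Qed.

(** The k-th derivative of z^s at 1 is the falling factorial of s, which the Stirling numbers expand
    in powers of s; summing over the gaps gives the genera. *)
Lemma horner_gap_poly m (d : 'I_m -> nat) k : ((gap_poly d)^`(k)).[1] = Phi d k.
Proof.
rewrite linear_sum horner_sum /Phi /genus.
under [RHS]eq_bigr => i _ do rewrite mulr_sumr.
rewrite exchange_big /=; apply: eq_bigr => s _.
by rewrite horner_stirling1 derivnXn hornerMn hornerXn expr1n natz.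
Qed.

(** * Alternating power sums from the derivatives of the numerator *)

Section PowerSums.

Variables (K : fieldType) (m : nat) (d : 'I_m -> nat).
Hypothesis m_ge2 : (2 <= m)%N.
Variable F : minimal_resolution K d.

(** The Stirling combination of the powers of C is the n-th derivative of z^C at 1. The minus sign
    comes from (-1)^(k+1) against (-1)^k. *)
Lemma stirling_power_sum n : (0 < n)%N ->
  \sum_(k < n.+1) stirling1 n k * alt_power_sum F k =
  - ((syzygy_poly F)^`(n)).[1].
Proof.
move=> n_gt0; rewrite /syzygy_poly.
rewrite linear_sum horner_sum.
have D k : (((-1) ^+ k * \sum_(j < betti F k) 'X^(syzdeg j))^`(n)).[1] =
   (-1) ^+ k * \sum_(j < betti F k) ((syzdeg j) ^_ n)%:Z.
  rewrite -signr_odd -[in RHS]signr_odd.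
  rewrite (_ : (_ * _)^`(n) = (-1) ^+ odd k * (\sum_(j < betti F k) 'X^(syzdeg j))^`(n)).
    rewrite hornerM horner_exp hornerN hornerC; congr (_ * _).
    rewrite linear_sum horner_sum; apply: eq_bigr => j _.
    by rewrite /= derivnXn hornerMn hornerXn expr1n natz.
  by case: odd; rewrite ?expr0 ?mul1r // expr1 !mulN1r derivnN.
under [in RHS]eq_bigr => k _ do rewrite D.
rewrite -(big_mkord xpredT (fun k => (-1) ^+ k * \sum_(j < betti F k) ((syzdeg j) ^_ n)%:Z)).
(* The term k = 0 is the constant 1, killed by differentiation since [n] is positive. *)
rewrite big_ltn ?(ltnW m_ge2) //.
rewrite [X in _ * X]big1 ?mulr0 ?add0r; last first.
  by move=> j _; rewrite syzdeg_0 ffact0n -(prednK n_gt0).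
rewrite /alt_power_sum -sumrN.
under eq_bigr => k _ do rewrite mulr_sumr.
rewrite exchange_big; apply: eq_bigr => k _.
rewrite -mulNr exprS mulN1r.
under eq_bigr => i _ do rewrite mulrCA mulr_sumr.
rewrite -mulr_sumr exchange_big; congr (_ * _).
by apply: eq_bigr => j _; rewrite horner_stirling1.
Qed.

Hypothesis hd : minimally_generates d.

(** Both terms of [syzygy_polyE] are divisible by (1 - X)^(m-1). *)
Lemma syzygy_poly_derivn_eq0 n : (n < m.-1)%N -> ((syzygy_poly F)^`(n)).[1] = 0.
Proof.
move=> lt_n; rewrite syzygy_polyE ?(ltnW m_ge2) // derivn_taylor1.
rewrite taylor1B !taylor1_powM coefB !mulrA !coefMXn lt_n.
by rewrite (leq_trans lt_n (leq_pred m)) subrr mul0r.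
Qed.

(** After the shifts, the coefficient of index m - 1 + r combines the r-th Taylor coefficient of
    [Psi_poly] with the (r-1)-th of [Psi_poly d * gap_poly d]. The factor r! keeps the identity
    integral. *)
Lemma syzygy_poly_derivn r :
  r`!%:R * ((syzygy_poly F)^`(m.-1 + r)).[1] =
  - ((-1) ^+ m * (m.-1 + r)`!%:R * Pi d r).
Proof.
have m_gt0 := ltnW m_ge2.
rewrite syzygy_polyE // derivn_taylor1 taylor1B !taylor1_powM coefB !mulrA.
rewrite !coefMXn ltnNge leq_addr /= addKn.
have sgn : (-1) ^+ m = - (-1) ^+ m.-1 :> {poly int}.
  by rewrite -{1}(prednK m_gt0) exprS mulN1r.
have sgn' : (-1) ^+ m = - (-1) ^+ m.-1 :> int.
  by rewrite -{1}(prednK m_gt0) exprS mulN1r.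
have coefS (p : {poly int}) i : ((-1) ^+ m.-1 * p)`_i = (-1) ^+ m.-1 * p`_i.
  by rewrite -signr_odd -[in RHS]signr_odd; case: odd;
     rewrite ?expr0 ?mul1r // expr1 !mulN1r coefN.
rewrite sgn mulNr coefN coefS sgn' /Pi.
set S := r%:R * _; set B := (if _ then _ else _).
(* For r = 0 the gap term vanishes to order m at 1 and contributes nothing. Otherwise r! = r (r-1)!,
   which gives the factor r and the Leibniz sum of order r - 1 in [Pi]. *)
have HB : B * r`!%:R = - (-1) ^+ m.-1 * S.
  rewrite {}/B {}/S; case: r => [|r]; first by rewrite addn0 ltn_predL m_gt0 !mul0r mulr0.
  rewrite -addSnnS prednK // ltnNge leq_addr /= addKn coefS.
  rewrite -mulNr -mulrA; congr (_ * _).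
  rewrite factS natrM mulrCA -derivn_taylor1 horner_derivnM; congr (_ * _).
  by apply: eq_bigr => k _; rewrite subn1 subSn ?horner_gap_poly // -ltnS.
rewrite [Psi d r]/Psi derivn_taylor1.
move: (_ ^+ _) B S HB (taylor1 _)`_r => e B S HB A.
transitivity ((e * A * r`!%:R - B * r`!%:R) * (m.-1 + r)`!%:R); first by ring.
by rewrite HB; ring.
Qed.

(** Strong induction: the Stirling matrix is unitriangular, its entry at index 0 is zero, and the
    derivative of order k vanishes, so the top term is zero. *)
Lemma alt_power_sum_eq0 k : (k < m.-1)%N -> (0 < k)%N -> alt_power_sum F k = 0.
Proof.
elim/ltn_ind: k => k IHk lt_k k_gt0.
have := stirling_power_sum k_gt0; rewrite syzygy_poly_derivn_eq0 // oppr0.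
rewrite big_ord_recr /= stirling1_lead mul1r big1 ?add0r // => i _.
have [->|i_gt0] := posnP i; first by rewrite stirling1_n0 ?mul0r.
by rewrite IHk ?mulr0 // (ltn_trans (ltn_ord i)).
Qed.

Lemma stirling_power_sum_Pi r :
  r`!%:R * \sum_(m.-1 <= k < (m.-1 + r).+1)
    stirling1 (m.-1 + r) k * alt_power_sum F k
  = (-1) ^+ m * (m.-1 + r)`!%:R * Pi d r.
Proof.
have n_gt0 : (0 < m.-1 + r)%N by rewrite addn_gt0 -ltnS prednK ?m_ge2 ?(ltnW m_ge2).
rewrite -[RHS]opprK -syzygy_poly_derivn -mulrN -stirling_power_sum //.
congr (_ * _); rewrite -(big_mkord xpredT (fun k => stirling1 _ k * alt_power_sum F k)).
(* The indices below m - 1 drop out: 0 by its Stirling number, the others by [alt_power_sum_eq0]. *)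
rewrite [RHS](big_cat_nat (n := m.-1)) //= ?ltnS ?leqW ?leq_addr //.
rewrite [X in _ = X + _]big_nat [X in _ = X + _]big1 ?add0r // => k /andP[_ lt_k].
have [->|k_gt0] := posnP k; first by rewrite stirling1_n0 ?mul0r.
by rewrite alt_power_sum_eq0 ?mulr0.
Qed.

End PowerSums.

(* The exponents m + p >= m - 1 and p + 1 >= 0 are non-negative integers; absz
   reads them as natural numbers. *)
Theorem mainTheorem5 (K : fieldType) (m : nat) (hm : (2 <= m)%N)
    (d : 'I_m -> nat) (hd : minimally_generates d)
    (F : minimal_resolution K d) (p : int) (hp : -1 <= p) :
  (\sum_(m.-1 <= k < (absz (m%:Z + p)).+1)
      stirling1 (absz (m%:Z + p)) k * alt_power_sum F k)%:~R
  = (-1) ^+ m * ((absz (m%:Z + p))`!%:R / (absz (p + 1))`!%:R)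
    * (Pi d (absz (p + 1)))%:~R :> rat.
Proof.
(* With r = p + 1, which is non-negative by [hp], one has m + p = (m - 1) + r; the integer identity
   is then divided by r! over the rationals. *)
set r := absz (p + 1); have -> : absz (m%:Z + p) = (m.-1 + r)%N by lia.
have fact_neq0 : r`!%:R != 0 :> rat by rewrite Num.Theory.pnatr_eq0 -lt0n fact_gt0.
apply: (mulfI fact_neq0).
have := congr1 (fun x : int => x%:~R : rat) (stirling_power_sum_Pi hm F hd r).
rewrite !rmorphM /= !rmorphXn /= !rmorph_nat rmorphN1 => ->.
by field.
Qed.
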